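(* Let $d\in\mathbb{N}$. Then the following holds: (i) A linear mapping $\mathbf{A}:\mathbb{S}_d\to\mathbb{S}_d$ satisfies $\mathrm{e}^{\mathbf{A}t}(\mathbb{S}_d^+)=\mathbb{S}_d^+$ for all $t\in\mathbb{R}^+$ if and only if there exists a matrix $A\in M_d(\mathbb{R})$ such that $\mathbf{A}X=AX+XA^{\mathrm{T}}$ for all $X\in\mathbb{S}_d$. (ii) A linear mapping $\mathbf{A}:\mathbb{S}_d\to\mathbb{S}_d$ satisfies $\mathrm{e}^{\mathbf{A}t}(\mathbb{S}_d^+)=\mathbb{S}_d^+$ for all $t\in\mathbb{R}$ if there exists an $\varepsilon>0$ such that $\mathrm{e}^{\mathbf{A}t}(\mathbb{S}_d^+)=\mathbb{S}_d^+$ for all $t\in[0,\varepsilon)$.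
   Context: $M_d(\mathbb{R})$ is the set of real $d\times d$ matrices, $\mathbb{S}_d$ the linear space of symmetric real $d\times d$ matrices, $\mathbb{S}_d^+\subset\mathbb{S}_d$ the closed cone of positive semidefinite matrices, and $\mathbb{R}^+=[0,\infty)$. $A^{\mathrm T}$ is the transpose of $A$. For a linear map $\mathbf{A}:\mathbb{S}_d\to\mathbb{S}_d$, $\mathrm{e}^{\mathbf{A}t}$ denotes the operator exponential of $t\mathbf{A}$, a linear map $\mathbb{S}_d\to\mathbb{S}_d$, and $\mathrm{e}^{\mathbf{A}t}(\mathbb{S}_d^+)$ is the image of $\mathbb{S}_d^+$ under it. *)

(* Defs.v *)
From HB Require Import structures.
From mathcomp Require Import all_boot all_order all_algebra.
From mathcomp Require Import all_classical all_reals all_analysis.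
From mathcomp Require Import ring.

Set Implicit Arguments.
Unset Strict Implicit.
Unset Printing Implicit Defensive.

Import Order.TTheory GRing.Theory Num.Theory.
Import numFieldNormedType.Exports.

Local Open Scope classical_set_scope.
Local Open Scope ring_scope.

Section SymmetricMatrices.
Variables (R : realType) (d : nat).

Lemma symmetricmxP (M : 'M[R]_d) : reflect (M^T = M) (M \is symmetricmx).
Proof.
rewrite is_hermitianmxE expr0 scale1r map_mx_id// eq_sym.
exact: eqP.
Qed.

Lemma symmetricmx_submod : submod_closed (symmetricmx : {pred 'M[R]_d}).
Proof.
split=> [|a M N /symmetricmxP MT /symmetricmxP NT]; apply/symmetricmxP.
  by rewrite trmx0.
by rewrite linearP/= MT NT.
Qed.

HB.instance Definition _ := GRing.isSubmodClosed.Build R 'M[R]_d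
  (symmetricmx : {pred 'M[R]_d}) symmetricmx_submod.

Record symmx := SymMx {
  symmx_val :> 'M[R]_d;
  symmx_valP : symmx_val \is symmetricmx }.

HB.instance Definition _ := [isSub for symmx_val].
HB.instance Definition _ := [Choice of symmx by <:].
HB.instance Definition _ := [SubChoice_isSubLmodule of symmx by <:].

End SymmetricMatrices.

Section SymmetricNorm.
Variables (R : realType) (d : nat).

Let sym_norm (X : symmx R d) : R := `|val X|.

Let sym_ler_normD (X Y : symmx R d) : sym_norm (X + Y) <= sym_norm X + sym_norm Y.
Proof. by rewrite /sym_norm raddfD/= ler_normD. Qed.

Let sym_normrZ (a : R) (X : symmx R d) : sym_norm (a *: X) = `|a| * sym_norm X.
Proof. by rewrite /sym_norm linearZ/= normrZ. Qed.

Let sym_normr0_eq0 (X : symmx R d) : sym_norm X = 0 -> X = 0.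
Proof. by move/eqP; rewrite normr_eq0 => /eqP X0; apply/val_inj. Qed.

(* All norms on this finite-dimensional space are equivalent, so the choice of
   the entrywise maximum norm does not affect the limits below. *)
HB.instance Definition _ := Lmodule_isNormed.Build R (symmx R d)
  sym_ler_normD sym_normrZ sym_normr0_eq0.

Definition psdmx : set (symmx R d) :=
  [set X | forall v : 'cV[R]_d, 0 <= (v^T *m val X *m v) 0 0].

End SymmetricNorm.
Arguments psdmx : clear implicits.

Section OperatorExponential.
Variables (R : realType) (V : normedModType R).

Definition exp_term (A : V -> V) (x : V) : V ^nat :=
  fun k => k`!%:R^-1 *: iter k A x.

(* The exponential series of the operator [A], summed pointwise.  On a
   finite-dimensional space pointwise convergence of linear operators is the
   same as convergence in operator norm; [is_cvg_opexp] below gives convergence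
   on [symmx R d], so the value of [limn] there is never a default. *)
Definition opexp (A : {linear V -> V}) (x : V) : V :=
  limn (series (exp_term A x)).

End OperatorExponential.

Section OperatorExponentialTheory.
Variables (R : realType) (d : nat).
Implicit Types (A : {linear symmx R d -> symmx R d}) (X : symmx R d).

Lemma symmx_normE X : `|X| = `|val X|. Proof. by []. Qed.

Lemma trmx_symmx X : (val X)^T = val X.
Proof. exact/symmetricmxP/symmx_valP. Qed.

Lemma symmx_complete (F : set_system (symmx R d)) :
  ProperFilter F -> cauchy F -> cvg F.
Proof.
move=> FF /(cauchyP (R := R)) Fc.
have vF : cauchy ((val : symmx R d -> 'M[R]_d) @ F).
  apply/(cauchyP (R := R)) => e e0; have [X FX] := Fc e e0.
  exists (val X); rewrite nbhs_simpl/=.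
  have : F (val @^-1` ball (val X) e); last by [].
  apply: filterS FX => Y; rewrite /preimage/= -!ball_normE /=.
  by rewrite symmx_normE raddfB.
have [M FM] := (cvg_ex _).1 ((cauchy_cvgP _).1 vF).
have Msym : M \is symmetricmx.
  apply/symmetricmxP; apply/matrixP => i j; rewrite mxE.
  have FMij k l : (fun X : symmx R d => val X k l) @ F --> M k l.
    exact: (cvg_comp _ (fun N : 'M[R]_d => N k l) FM (@coord_continuous _ _ _ k l M)).
  have symE : (fun X : symmx R d => val X j i) = (fun X => val X i j).
    by apply/funext => X; rewrite -[in RHS](trmx_symmx X) mxE.
  have := FMij j i; rewrite symE => FMji.
  exact: (cvg_unique _ FMji (FMij i j)).
apply/cvg_ex; exists (SymMx Msym); apply/cvgrPdist_lt => e e0.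
move/cvgrPdist_lt : FM => /(_ _ e0); apply: filterS => X /=.
by rewrite symmx_normE raddfB.
Qed.

HB.instance Definition _ :=
  Uniform_isComplete.Build (symmx R d) symmx_complete.

Fact sym_delta_subproof i j :
  2^-1 *: (delta_mx i j + delta_mx j i) \is (symmetricmx : qualifier 0 'M[R]_d).
Proof. by apply/symmetricmxP; rewrite linearZ/= raddfD/= !trmx_delta addrC. Qed.

Definition sym_delta i j := SymMx (sym_delta_subproof i j).

Lemma symmx_sum_delta X : X = \sum_i \sum_j val X i j *: sym_delta i j.
Proof.
apply: val_inj; rewrite [RHS]raddf_sum.
transitivity (2^-1 *: (val X + (val X)^T)).
  rewrite trmx_symmx scalerDr -scalerDl.
  by rewrite (_ : _ + _ = 1 :> R) ?scale1r//; field.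
rewrite {1 2}(matrix_sum_delta (val X)) (raddf_sum trmx)/=.
rewrite -big_split/= scaler_sumr.
apply: eq_bigr => i _; rewrite -[RHS]/(val _) [RHS]raddf_sum (raddf_sum trmx)/=.
rewrite -big_split/= scaler_sumr.
apply: eq_bigr => j _; rewrite [_^T]linearZ/= trmx_delta -scalerDr !scalerA.
by rewrite mulrC.
Qed.

Lemma symmx_linear_bounded A :
  exists2 C : R, 0 <= C & forall X, `|A X| <= C * `|X|.
Proof.
exists (\sum_i \sum_j `|A (sym_delta i j)|).
  by apply: sumr_ge0 => i _; apply: sumr_ge0 => j _.
move=> X; rewrite {1}(symmx_sum_delta X) linear_sum mulr_suml.
apply: le_trans (ler_norm_sum _ _ _) _; apply: ler_sum => i _.
rewrite linear_sum mulr_suml.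
apply: le_trans (ler_norm_sum _ _ _) _; apply: ler_sum => j _.
rewrite linearZ/= normrZ mulrC ler_wpM2l// symmx_normE.
rewrite [leRHS]/Num.norm/= mx_normrE.
exact: (le_bigmax _ (fun ij => `|val X ij.1 ij.2|) (i, j)).
Qed.

Lemma is_cvg_opexp A X : cvgn (series (exp_term A X)).
Proof.
have [C C0 AC] := symmx_linear_bounded A.
apply: normed_cvg; apply: (@series_le_cvg _ _ (`|X| *: exp_coeff C)).
- by move=> n /=.
- move=> n; rewrite [leRHS]/(`|X| * (C ^+ n / n`!%:R)).
  by rewrite mulr_ge0// divr_ge0// exprn_ge0.
- move=> n; have -> : (`|X| *: exp_coeff C) n = n`!%:R^-1 * (`|X| * C ^+ n).
    by rewrite mulrC -mulrA.
  rewrite /exp_term/= normrZ ger0_norm ?invr_ge0// ler_wpM2l ?invr_ge0//.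
  elim: n => [|n IHn] /=; first by rewrite expr0 mulr1.
  by rewrite (le_trans (AC _))// exprS mulrCA ler_wpM2l.
- exact/is_cvg_seriesZ/is_cvg_series_exp_coeff.
Qed.

Lemma opexp_linear A : linear (opexp A : symmx R d -> symmx R d).
Proof.
move=> a X Y; rewrite /opexp.
have -> : exp_term A (a *: X + Y) = a *: exp_term A X + exp_term A Y.
  apply/funext => n; rewrite -[RHS]/(a *: exp_term A X n + exp_term A Y n).
  rewrite /exp_term.
  have -> : iter n A (a *: X + Y) = a *: iter n A X + iter n A Y.
    by elim: n => //= n ->; rewrite linearP.
  by rewrite scalerDr !scalerA mulrC -scalerA.
have cX := is_cvg_opexp (A := A) (X := X).
have cY := is_cvg_opexp (A := A) (X := Y).
rewrite seriesD seriesZ; apply: cvg_lim => //.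
exact: cvgD (cvgZl_tmp (k:=a) cX) cY.
Qed.

HB.instance Definition _ A :=
  GRing.isLinear.Build R (symmx R d) (symmx R d) _ (opexp A) (opexp_linear A).

End OperatorExponentialTheory.

(* Main.v *)
Require Import Defs.
From HB Require Import structures.
From mathcomp Require Import all_boot all_order all_algebra.
From mathcomp Require Import all_classical all_reals all_analysis.
From mathcomp Require Import ring lra.

(** Both parts reduce to one equivalence between an infinitesimal and a global
    property.

    Sufficiency. If [A X = B X + X B^T], then [A] is the sum of left
    multiplication by [B] and right multiplication by [B^T]. These two operators
    on square matrices commute, so the exponential of their sum is the
    composition of their exponentials ([opexpD]), whence
    [exp (t A) X = E X E^T] with [E = exp (t B)] ([opexp_lyapunov]). Such a
    congruence preserves positive semidefiniteness, for every real [t]; as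
    [exp (- t A)] is a right inverse of [exp (t A)] ([opexp_scaleK]), the cone
    is not only preserved but mapped onto itself ([lyapunov_opexp_psdmx]).

    Necessity. Suppose [exp (t A)] maps the cone onto itself for small
    nonnegative [t]. Being injective, it has an inverse that also preserves the
    cone, so [exp (t A) X] is positive semidefinite for [t] of either sign, when
    [X] is. If moreover [v^T X v = 0], the function [v^T (exp (t A) X) v] is
    nonnegative around [t = 0] and vanishes there, so its derivative
    [v^T (A X) v] is zero ([psdmx_face_invariant]). Applied to [X = u u^T], this
    says that [v^T A(u u^T) v = 0] whenever [u] and [v] are orthogonal, and
    linear algebra does the rest ([face_invariant_lyapunov]): the matrices
    [A (e_i e_i^T)] dictate the columns of [B], and the difference between [A]
    and [X |-> B X + X B^T], which satisfies the same orthogonality condition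
    and kills each [e_i e_i^T], kills everything.

    Only small [t >= 0] enter the necessity argument while the sufficiency
    argument gives all real [t], so part (ii) follows from the same two
    implications as part (i). *)

Set Implicit Arguments.
Unset Strict Implicit.
Unset Printing Implicit Defensive.

Import Order.TTheory GRing.Theory Num.Theory.
Import numFieldNormedType.Exports.

Local Open Scope classical_set_scope.
Local Open Scope ring_scope.

(** * The Cauchy product of exponential partial sums *)

Section Triangle.
Variable V : zmodType.

Lemma sum_triangle_diag (a : nat -> nat -> V) n :
  \sum_(0 <= i < n) \sum_(0 <= j < n - i) a i j =
  \sum_(0 <= k < n) \sum_(0 <= i < k.+1) a i (k - i)%N.
Proof.
elim: n => [|n IH]; first by rewrite !big_geq.
rewrite [RHS]big_nat_recr//= -IH big_nat_recr//= subSnn big_nat1.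
rewrite [X in _ = _ + X]big_nat_recr//= subnn addrA; congr (_ + _).
rewrite -big_split/=; apply: eq_big_nat => i /andP[_ ltin].
by rewrite subSn ?(ltnW ltin)// big_nat_recr.
Qed.

(** This compares the product of two partial sums of length [n] (a square of
    indices) with a partial sum of their Cauchy product (a triangle cut into
    antidiagonals). *)
Lemma sum_square_triangle (a : nat -> nat -> V) n :
  \sum_(0 <= i < n) \sum_(0 <= j < n) a i j =
  \sum_(0 <= k < n) \sum_(0 <= i < k.+1) a i (k - i)%N +
  \sum_(0 <= i < n) \sum_(n - i <= j < n) a i j.
Proof.
rewrite -sum_triangle_diag -big_split/=; apply: eq_big_nat => i _.
by rewrite -big_cat_nat// leq_subr.
Qed.

End Triangle.

Section CommutingOperators.
Variables (R : numFieldType) (V : lmodType R).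

(** The binomial theorem for commuting operators, with the factorials
    distributed so that the coefficients are those of the product of two
    exponential series. *)
Lemma iter_addfun_binomial (L M : {linear V -> V}) :
  (forall x, L (M x) = M (L x)) -> forall k x,
  k`!%:R^-1 *: iter k (L \+ M) x =
  \sum_(0 <= i < k.+1)
    (i`!%:R^-1 * (k - i)`!%:R^-1) *: iter i L (iter (k - i) M x).
Proof.
move=> LM; have MiL i x : M (iter i L x) = iter i L (M x).
  by elim: i => //= i <-; rewrite LM.
have fS (i : nat) : (i.+1)%:R * (i.+1)`!%:R^-1 = i`!%:R^-1 :> R.
  by rewrite factS natrM invfM mulrA divff ?mul1r// pnatr_eq0.
elim=> [|k IH] x; first by rewrite big_nat1 fact0 invr1 mulr1 !scale1r.
have k0 : (k.+1%:R : R) != 0 by rewrite pnatr_eq0.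
apply: (scalerI k0); rewrite scalerA fS iterS.
transitivity ((L \+ M) (k`!%:R^-1 *: iter k (L \+ M) x)).
  by rewrite /= !linearZ/= scalerDr.
rewrite IH/= !linear_sum/=.
(* Splitting the factor k+1 as i + (k+1-i) on each term cancels one factor of
   one of the two factorials, which matches an application of L or of M. *)
rewrite [RHS](eq_big_nat _ _ (F2 := fun i =>
  (i%:R * (i`!%:R^-1 * (k.+1 - i)`!%:R^-1)) *: iter i L (iter (k.+1 - i) M x) +
  ((k.+1 - i)%:R * (i`!%:R^-1 * (k.+1 - i)`!%:R^-1)) *:
    iter i L (iter (k.+1 - i) M x))); last first.
  move=> i /andP[_ ile]; rewrite scalerA -scalerDl -mulrDl -natrD subnKC//.
rewrite big_split/=; congr (_ + _).
  rewrite [RHS]big_nat_recl//= mul0r scale0r add0r.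
  apply: eq_big_nat => i _; rewrite linearZ/= subSS mulrA fS.
  by [].
rewrite [RHS]big_nat_recr//= subnn mul0r scale0r addr0.
apply: eq_big_nat => i /andP[_]; rewrite ltnS => ile.
by rewrite linearZ/= subSn// iterS mulrCA fS MiL.
Qed.

End CommutingOperators.

(** * Exponentials of bounded operators *)

Lemma continuous_linear_bound (R : realType) (U W : normedModType R)
    (f : {linear U -> W}) :
  continuous f -> exists2 C : R, 0 <= C & forall x, `|f x| <= C * `|x|.
Proof.
move=> /(_ 0)/continuous_linear_bounded/linear_boundedP fb.
have [C [C0 fC]] : exists C : R, 0 <= C /\ forall x, `|f x| <= C * `|x|.
  near +oo_R => C; exists C; split; first by near: C; apply: nbhs_pinfty_ge.
  by near: C.
by exists C.
Unshelve. all: by end_near. Qed.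

Lemma bounded_linear_map_continuous (R : realType) (U W : normedModType R)
    (f : {linear U -> W}) (C : R) :
  (forall x, `|f x| <= C * `|x|) -> continuous f.
Proof.
move=> fC; apply/linear_bounded_continuous/linear_boundedP.
near=> r => x; apply: le_trans (fC x) _; apply: ler_wpM2r => //.
Unshelve. all: by end_near. Qed.

Section BoundedOperators.
Variables (R : realType) (V : completeNormedModType R).
Implicit Types (A L M : {linear V -> V}) (x : V) (C : R).

Lemma norm_iter A C x k : 0 <= C -> (forall y, `|A y| <= C * `|y|) ->
  `|iter k A x| <= C ^+ k * `|x|.
Proof.
move=> C0 AC; elim: k => [|k IH]; first by rewrite expr0 mul1r.
by rewrite iterS (le_trans (AC _))// exprS -mulrA ler_wpM2l.
Qed.

Lemma norm_exp_term A C x k : 0 <= C -> (forall y, `|A y| <= C * `|y|) ->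
  `|exp_term A x k| <= exp_coeff C k * `|x|.
Proof.
move=> C0 AC; rewrite /exp_term /exp_coeff/= normrZ ger0_norm ?invr_ge0//.
by rewrite mulrAC mulrC ler_wpM2r ?invr_ge0// norm_iter.
Qed.

Lemma norm_series_exp_term A C x n : 0 <= C -> (forall y, `|A y| <= C * `|y|) ->
  `|series (exp_term A x) n| <= series (exp_coeff C) n * `|x|.
Proof.
move=> C0 AC; rewrite /series/= mulr_suml (le_trans (ler_norm_sum _ _ _))//.
by apply: ler_sum => i _; exact: norm_exp_term.
Qed.

Lemma series_exp_coeff_le_expR C n : 0 <= C -> series (exp_coeff C) n <= expR C.
Proof.
move=> C0; apply: nondecreasing_cvgn_le; last exact: is_cvg_series_exp_coeff.
apply/nondecreasing_seqP => m; rewrite /series/= big_nat_recr//= lerDl.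
by rewrite divr_ge0 ?exprn_ge0.
Qed.

Lemma cvg_opexp A x : continuous A -> series (exp_term A x) @ \oo --> opexp A x.
Proof.
move=> /continuous_linear_bound[C C0 AC]; apply: normed_cvg.
apply: (@series_le_cvg _ _ (`|x| *: exp_coeff C)) => [n|n|n|] //=.
- rewrite -[_ n]/(`|x| * (C ^+ n / n`!%:R)).
  by rewrite mulr_ge0// divr_ge0// exprn_ge0.
- rewrite -[X in _ <= X]/(`|x| * exp_coeff C n) mulrC.
  exact: norm_exp_term.
- exact/is_cvg_seriesZ/is_cvg_series_exp_coeff.
Qed.

(** The main computing device below: a continuous linear map that carries [A]
    to [A'] on vectors does so on each partial sum, hence on the
    exponentials. *)
Lemma opexp_intertwine (W : completeNormedModType R) (f : {linear V -> W})
    A (A' : {linear W -> W}) : continuous f -> continuous A ->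
  (forall x, f (A x) = A' (f x)) -> forall x, f (opexp A x) = opexp A' (f x).
Proof.
move=> fc Ac fA x; apply/esym/cvg_lim => //.
have -> : series (exp_term A' (f x)) = f \o series (exp_term A x).
  apply/funext => n; rewrite /series/= linear_sum/=; apply: eq_bigr => i _.
  rewrite /exp_term linearZ/=; congr (_ *: _).
  by elim: i => //= i ->; rewrite fA.
exact: (cvg_comp _ f (cvg_opexp (x := x) Ac) (fc _)).
Qed.

(** The scalar exponential at [C] dominates the series term by term, so it also
    dominates the remainder of order two. *)
Lemma opexp_first_order A C x : continuous A -> 0 <= C ->
  (forall y, `|A y| <= C * `|y|) ->
  `|opexp A x - (x + A x)| <= (expR C - (1 + C)) * `|x|.
Proof.
move=> Ac C0 AC; have xc := cvg_opexp (x := x) Ac.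
apply: (@ler_cvg_to _ \oo _ R
  (fun n => `|series (exp_term A x) n - (x + A x)|)
  (fun n => (series (exp_coeff C) n - (1 + C)) * `|x|)).
- by apply: cvg_norm; apply: cvgB => //; exact: cvg_cst.
- apply: cvgMl; apply: cvgB; last exact: cvg_cst.
  exact: is_cvg_series_exp_coeff.
- exists 2%N => // n /= n2; rewrite /series/=.
  have split2 (T : zmodType) (u : nat -> T) :
      \sum_(0 <= i < n) u i - (u 0%N + u 1%N) = \sum_(2 <= i < n) u i.
    have <- : \sum_(0 <= i < 2) u i = u 0%N + u 1%N.
      by rewrite big_nat_recr//= big_nat1.
    rewrite (@big_cat_nat _ _ _ 2 0 n)//=.
    by rewrite addrAC subrr add0r.
  have -> : x + A x = exp_term A x 0 + exp_term A x 1.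
    by rewrite /exp_term /= fact0 invr1 !scale1r.
  have -> : 1 + C = exp_coeff C 0 + exp_coeff C 1.
    by rewrite /exp_coeff/= fact0 expr0 expr1 invr1 !mulr1.
  rewrite !split2 mulr_suml (le_trans (ler_norm_sum _ _ _))//.
  by apply: ler_sum => i _; exact: norm_exp_term.
Qed.

Lemma expR_second_order C : 0 <= C -> expR C - (1 + C) <= C ^+ 2 * expR C.
Proof.
move=> C0.
(* This is exp (-C) >= 1 - C multiplied by exp C. *)
have eC : expR C - 1 <= C * expR C.
  have := ler_wpM2r (expR_ge0 C) (expR_ge1Dx (- C)).
  by rewrite -expRD addNr expR0 mulrDl mul1r mulNr; lra.
have : C * (expR C - 1) <= C * (C * expR C) by rewrite ler_wpM2l.
by rewrite expr2 -mulrA; lra.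
Qed.

Lemma series_exp_termB A x y n :
  series (exp_term A (x - y)) n =
  series (exp_term A x) n - series (exp_term A y) n.
Proof.
rewrite /series/= -sumrB; apply: eq_bigr => i _; rewrite /exp_term -scalerBr.
by congr (_ *: _); elim: i => //= i ->; rewrite linearB.
Qed.

(** The partial sums are bounded operators uniformly in [n], so they may be
    applied to a convergent sequence. *)
Lemma cvg_series_exp_term_diag A (z : V^nat) y :
  continuous A -> z @ \oo --> y ->
  (fun n => series (exp_term A (z n)) n) @ \oo --> opexp A y.
Proof.
move=> Ac zy; have [C C0 AC] := continuous_linear_bound Ac.
have -> : (fun n => series (exp_term A (z n)) n) =
    (fun n => series (exp_term A (z n - y)) n) + series (exp_term A y).
  apply/funext => n.
  rewrite -[RHS]/(series (exp_term A (z n - y)) n + series (exp_term A y) n).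
  by rewrite series_exp_termB subrK.
rewrite -[opexp A y]add0r; apply: cvgD; last exact: cvg_opexp.
apply/norm_cvg0P.
apply: (squeeze_cvgr (f := fun=> 0) (h := fun n => expR C * `|z n - y|)).
- apply: nearW => n; rewrite normr_ge0/=.
  rewrite (le_trans (norm_series_exp_term _ _ C0 AC))//.
  by rewrite ler_wpM2r// series_exp_coeff_le_expR.
- exact: cvg_cst.
- rewrite -(mulr0 (expR C)); apply: cvgMr; apply/norm_cvg0P.
  by rewrite -(subrr y); apply: cvgB => //; exact: cvg_cst.
Qed.

Lemma iter_linear_sum A k (I : Type) (r : seq I) (c : I -> R) (u : I -> V) :
  iter k A (\sum_(i <- r) c i *: u i) = \sum_(i <- r) c i *: iter k A (u i).
Proof.
elim: k => //= k ->; rewrite linear_sum; apply: eq_bigr => i _.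
by rewrite linearZ.
Qed.

(** The partial sum of the left side differs from the composition of the two
    partial sums by the terms [L^i M^j x / (i! j!)] with [i + j >= n]. Their sum
    has norm at most [|x|] times the same remainder for the scalars [l] and [m]
    bounding [L] and [M], which tends to [exp l * exp m - exp (l + m) = 0]. *)
Lemma opexpD L M : continuous L -> continuous M ->
  (forall x, L (M x) = M (L x)) ->
  forall x, opexp (L \+ M) x = opexp L (opexp M x).
Proof.
move=> Lc Mc LM x; have [l l0 Ll] := continuous_linear_bound Lc.
have [m m0 Mm] := continuous_linear_bound Mc.
pose c i j : R := i`!%:R^-1 * j`!%:R^-1.
pose rem n := \sum_(0 <= i < n) \sum_(n - i <= j < n)
  c i j *: iter i L (iter j M x).
pose srem n := \sum_(0 <= i < n) \sum_(n - i <= j < n)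
  c i j * (l ^+ i * m ^+ j).
have LME n : series (exp_term (L \+ M) x) n =
    series (exp_term L (series (exp_term M x) n)) n - rem n.
  have -> : series (exp_term L (series (exp_term M x) n)) n =
      \sum_(0 <= i < n) \sum_(0 <= j < n) c i j *: iter i L (iter j M x).
    apply: eq_bigr => i _; rewrite /exp_term /series/= iter_linear_sum.
    rewrite scaler_sumr.
    by apply: eq_bigr => j _; rewrite scalerA.
  rewrite sum_square_triangle addrK; apply: eq_bigr => k _.
  by rewrite /exp_term iter_addfun_binomial.
have sremE n : srem n = series (exp_coeff l) n * series (exp_coeff m) n -
    series (exp_coeff (l + m)) n.
  have -> : series (exp_coeff l) n * series (exp_coeff m) n =
      \sum_(0 <= i < n) \sum_(0 <= j < n) c i j * (l ^+ i * m ^+ j).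
    rewrite /series/= mulr_suml; apply: eq_bigr => i _.
    rewrite mulr_sumr; apply: eq_bigr => j _.
    by rewrite /exp_coeff/= /c; ring.
  rewrite sum_square_triangle.
  rewrite [X in X + _ - _](_ : _ = series (exp_coeff (l + m)) n).
    by rewrite addrC addKr.
  apply: eq_bigr => k _; rewrite /exp_coeff/=.
  rewrite (addrC l) exprDn big_mkord mulr_suml; apply: eq_bigr => i _.
  have ik : (i <= k)%N by rewrite -ltnS.
  rewrite /c -(bin_fact ik) !natrM -mulr_natr; field.
  by rewrite !pnatr_eq0 -!lt0n !fact_gt0 bin_gt0 ik.
apply: cvg_lim => //; rewrite (funext LME) -[opexp L _]subr0.
apply: cvgB; first by apply: cvg_series_exp_term_diag => //; exact: cvg_opexp.
apply/norm_cvg0P.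
apply: (squeeze_cvgr (f := fun=> 0) (h := fun n => srem n * `|x|)).
- apply: nearW => n; rewrite normr_ge0/= /rem /srem mulr_suml.
  rewrite (le_trans (ler_norm_sum _ _ _))//; apply: ler_sum => i _.
  rewrite mulr_suml (le_trans (ler_norm_sum _ _ _))//; apply: ler_sum => j _.
  have c0 : 0 <= c i j by rewrite mulr_ge0// invr_ge0.
  rewrite normrZ ger0_norm// -mulrA ler_wpM2l// -mulrA.
  rewrite (le_trans (norm_iter _ _ l0 Ll))//.
  by rewrite ler_wpM2l ?exprn_ge0// norm_iter.
- exact: cvg_cst.
- rewrite -(mul0r `|x|); apply: cvgMl; rewrite (funext sremE).
  rewrite -(subrr (expR (l + m))) {1}expRD.
  apply: cvgB; last exact: is_cvg_series_exp_coeff.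
  by apply: cvgM; exact: is_cvg_series_exp_coeff.
Qed.

End BoundedOperators.

(** * Operators of Lyapunov type *)

(** Matrices are a complete normed module; declaring the join of the two
    structures makes exponentials of operators on matrices available. *)
HB.instance Definition _ (R : realType) m n := NormedModule.on 'M[R]_(m, n).

Section LinearMapsOfMatrices.
Variable R : realType.

Lemma mx_linear_continuous m n (W : normedModType R)
  (f : {linear 'M[R]_(m, n) -> W}) : continuous f.
Proof.
apply: (@bounded_linear_map_continuous R _ _ _
  (\sum_i \sum_j `|f (delta_mx i j)|)) => X.
rewrite {1}(matrix_sum_delta X) linear_sum mulr_suml.
apply: le_trans (ler_norm_sum _ _ _) _; apply: ler_sum => i _.
rewrite linear_sum mulr_suml.
apply: le_trans (ler_norm_sum _ _ _) _; apply: ler_sum => j _.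
rewrite linearZ/= normrZ mulrC ler_wpM2l//.
rewrite [leRHS]/Num.norm/= mx_normrE.
exact: (le_bigmax _ (fun ij => `|X ij.1 ij.2|) (i, j)).
Qed.

Variable d : nat.

Lemma symmx_linear_continuous (A : {linear symmx R d -> symmx R d}) :
  continuous A.
Proof.
have [C _ AC] := symmx_linear_bounded A.
exact: bounded_linear_map_continuous AC.
Qed.

Lemma symmx_val_continuous : continuous (val : symmx R d -> 'M[R]_d).
Proof.
apply: (@bounded_linear_map_continuous R _ _
  (val : {linear symmx R d -> 'M[R]_d}) 1) => X.
by rewrite mul1r.
Qed.

End LinearMapsOfMatrices.

Section Lyapunov.
Variables (R : realType) (d : nat).
Implicit Types (A : {linear symmx R d -> symmx R d}) (B : 'M[R]_d).

Definition expmx B : 'M[R]_d := opexp (mulmx B) 1%:M.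

(** Right multiplication by [Y] commutes with left multiplication by [B] and
    sends the identity to [Y]. *)
Lemma opexp_mulmx B (Y : 'M[R]_d) : opexp (mulmx B) Y = expmx B *m Y.
Proof.
have BY X : mulmxr Y (mulmx B X) = mulmx B (mulmxr Y X) by rewrite /= mulmxA.
have := opexp_intertwine (@mx_linear_continuous _ _ _ _ (mulmxr Y))
  (@mx_linear_continuous _ _ _ _ (mulmx B)) BY 1%:M.
by rewrite /= mul1mx => <-.
Qed.

(** The map [Z |-> Y Z^T] turns left multiplication by [B] into right
    multiplication by [B^T]. *)
Lemma opexp_mulmxr_trmx B (Y : 'M[R]_d) :
  opexp (mulmxr B^T) Y = Y *m (expmx B)^T.
Proof.
pose f : {linear 'M[R]_d -> 'M[R]_d} := mulmx Y \o trmx.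
have BY X : f (mulmx B X) = mulmxr B^T (f X) by rewrite /= trmx_mul mulmxA.
have := opexp_intertwine (@mx_linear_continuous _ _ _ _ f)
  (@mx_linear_continuous _ _ _ _ (mulmx B)) BY 1%:M.
by rewrite /= trmx1 mulmx1 => <-.
Qed.

Lemma opexp_lyapunov A B :
  (forall X, A X = B *m X + X *m B^T :> 'M[R]_d) ->
  forall X, opexp A X = expmx B *m X *m (expmx B)^T :> 'M[R]_d.
Proof.
move=> AE X.
have := @opexp_intertwine R _ _ (val : {linear symmx R d -> 'M[R]_d}) A
  (mulmx B \+ mulmxr B^T) (@symmx_val_continuous _ _)
  (@symmx_linear_continuous _ _ A) AE X.
rewrite opexpD.
- by rewrite opexp_mulmxr_trmx opexp_mulmx mulmxA.
- exact: mx_linear_continuous.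
- exact: mx_linear_continuous.
- by move=> Y /=; rewrite mulmxA.
Qed.

(** [t A] and [- t A] commute and their sum is the zero operator, whose
    exponential is the identity by the first-order bound with constant 0. *)
Lemma opexp_scaleK A (t : R) : cancel (opexp (- t \*: A)) (opexp (t \*: A)).
Proof.
move=> X; rewrite -opexpD.
- have := @opexp_first_order R _ ((t \*: A) \+ (- t \*: A)) 0 X.
  rewrite expR0 addr0 subrr mul0r normr_le0 => h; apply/eqP.
  have A0 Y : (t \*: A) Y + (- t \*: A) Y = 0 by rewrite /= scaleNr subrr.
  move: h; rewrite /= A0 addr0 subr_eq0; apply => //.
    exact: symmx_linear_continuous.
  by move=> Y; rewrite A0 normr0 mul0r.
- exact: symmx_linear_continuous.
- exact: symmx_linear_continuous.
- by move=> Y /=; rewrite !linearZ/= !scalerA mulrC.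
Qed.

Lemma lyapunov_opexp_psdmx A B :
  (forall X, A X = B *m X + X *m B^T :> 'M[R]_d) ->
  forall t : R, opexp (t \*: A) @` psdmx R d = psdmx R d.
Proof.
move=> AE.
have psd t X : psdmx R d X -> psdmx R d (opexp (t \*: A) X).
  move=> Xpsd v.
  have tAE Y :
      (t \*: A) Y = (t *: B) *m Y + Y *m (t *: B)^T :> 'M[R]_d.
    rewrite -[LHS]/(val (t *: A Y)) linearZ/= AE scalerDr linearZ/=.
    by rewrite -scalemxAl -scalemxAr.
  rewrite -[val _]/(symmx_val _) (opexp_lyapunov tAE).
  have := Xpsd ((expmx (t *: B))^T *m v).
  by rewrite trmx_mul trmxK !mulmxA.
move=> t; apply/seteqP; split=> [_ [X Xpsd <-]|X Xpsd]; first exact: psd.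
by exists (opexp (- t \*: A) X); [exact: psd|exact: opexp_scaleK].
Qed.

End Lyapunov.

(** * Quadratic forms *)

Section QuadraticForms.
Variables (R : realType) (d : nat).
Implicit Types (v x y : 'cV[R]_d) (M : 'M[R]_d).

(** The codomain is [R^o], the field as a module over itself, so that the form
    is a linear map of [M] between normed modules. *)
Definition quad v M : R^o := (v^T *m M *m v) 0 0.

Lemma quad_linear v : linear (quad v).
Proof.
by move=> a M N; rewrite /quad mulmxDr mulmxDl -scalemxAr -scalemxAl !mxE.
Qed.

HB.instance Definition _ v :=
  GRing.isLinear.Build R 'M[R]_d R^o _ (quad v) (quad_linear v).

Lemma quad_parallelogram x y M :
  quad (x + y) M + quad (x - y) M = 2 * quad x M + 2 * quad y M.
Proof.
have addE (a b : 'M[R]_1) : (a + b) 0 0 = a 0 0 + b 0 0 by rewrite mxE.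
have oppE (a : 'M[R]_1) : (- a) 0 0 = - a 0 0 by rewrite mxE.
rewrite /quad ![(_ + _)^T]linearD/= [(- y)^T]linearN/= !mulmxDl !mulNmx.
rewrite !mulmxDr !mulmxN !(addE, oppE); ring.
Qed.

Lemma quad_delta_add M (k l : 'I_d) :
  quad (delta_mx k 0 + delta_mx l 0) M = M k k + M k l + M l k + M l l.
Proof.
have E (i j : 'I_d) : ((delta_mx i 0 : 'cV[R]_d)^T *m M *m
    (delta_mx j 0 : 'cV[R]_d)) 0 0 = M i j.
  by rewrite trmx_delta -rowE -colE !mxE.
have addE (a b : 'M[R]_1) : (a + b) 0 0 = a 0 0 + b 0 0 by rewrite mxE.
by rewrite /quad [(_ + _)^T]linearD/= !mulmxDl !mulmxDr !addE !E; ring.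
Qed.

Lemma quad_delta M (k : 'I_d) : quad (delta_mx k 0) M = M k k.
Proof. by rewrite /quad trmx_delta -rowE -colE !mxE. Qed.

Lemma quad_polar0 M (k l : 'I_d) : M^T = M -> quad (delta_mx k 0) M = 0 ->
  quad (delta_mx l 0) M = 0 -> quad (delta_mx k 0 + delta_mx l 0) M = 0 ->
  M k l = 0.
Proof.
move=> MT; rewrite !quad_delta quad_delta_add => -> ->.
have -> : M l k = M k l by rewrite -[in LHS]MT mxE.
lra.
Qed.

(** A quadratic form that vanishes off two hyperplanes vanishes, since any [v]
    is the midpoint of [v + y] and [v - y] with [v + y], [v - y] and [y] all
    off these hyperplanes, and the parallelogram law applies. *)
Lemma quad_eq0 M (i j : 'I_d) : M^T = M ->
  (forall v, v i 0 * v j 0 * quad v M = 0) -> M = 0.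
Proof.
move=> MT vM.
have qM v : v i 0 != 0 -> v j 0 != 0 -> quad v M = 0.
  move=> vi vj; have /eqP := vM v.
  by rewrite !mulf_eq0 (negPf vi) (negPf vj) => /eqP.
have q0 v : quad v M = 0.
  pose c := `|v i 0| + `|v j 0| + 1.
  pose y : 'cV[R]_d := const_mx c.
  have ci (k : 'I_d) : `|v k 0| < c -> ((v + y) k 0 != 0) * ((v - y) k 0 != 0).
    rewrite !mxE ltr_norml => /andP[h1 h2]; split; apply/eqP; lra.
  have [ai aj] : `|v i 0| < c /\ `|v j 0| < c.
    have := normr_ge0 (v i 0); have := normr_ge0 (v j 0).
    by rewrite /c; split; lra.
  have c0 : c != 0 by rewrite gt_eqF// (le_lt_trans _ ai).
  have := quad_parallelogram v y M.
  rewrite (qM (v + y)) ?ci// (qM (v - y)) ?ci// (qM y) ?mxE//; lra.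
by apply/matrixP => k l; rewrite mxE; exact: quad_polar0.
Qed.

End QuadraticForms.

(** * First-order consequences of preserving the cone *)

Section TangentVanishing.
Variables (R : realType) (V : completeNormedModType R).

(** A function that is nonnegative near 0 and null at 0 has a null derivative
    there; [q (A x)] is the derivative at 0 of [q (exp (t A) x)]. *)
Lemma opexp_tangent0 (q : {linear V -> R^o}) (A : {linear V -> V}) (x : V)
    (e : R) :
  continuous q -> continuous A -> 0 < e ->
  (forall t : R, `|t| < e -> 0 <= q (opexp (t \*: A) x)) ->
  q x = 0 -> q (A x) = 0.
Proof.
move=> qc Ac e0 qpos qx0.
have [K K0 qK] := continuous_linear_bound qc.
have [C C0 AC] := continuous_linear_bound Ac.
pose H := K * (C ^+ 2 * expR C * `|x|).
have H0 : 0 <= H by rewrite !mulr_ge0// ?exprn_ge0// expR_ge0.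
have step (t : R) : `|t| < e -> `|t| <= 1 -> 0 <= t * q (A x) + H * t ^+ 2.
  move=> te t1.
  have tC0 : 0 <= `|t| * C by rewrite mulr_ge0.
  have tAC y : `|(t \*: A) y| <= `|t| * C * `|y|.
    by rewrite /= normrZ -mulrA ler_wpM2l.
  have := opexp_first_order x (bounded_linear_map_continuous tAC) tC0 tAC.
  move=> /le_trans/(_ (ler_wpM2r (normr_ge0 x) (expR_second_order tC0))).
  move=> /(ler_wpM2l K0) h; have := le_trans (qK _) h.
  rewrite linearB linearD/= qx0 add0r linearZ/= ler_norml => /andP[_ hq].
  have eC : expR (`|t| * C) <= expR C by rewrite ler_expR ler_piMl.
  have : K * ((`|t| * C) ^+ 2 * expR (`|t| * C) * `|x|) <= H * t ^+ 2.
    pose c := K * (t ^+ 2 * C ^+ 2 * `|x|).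
    have c0 : 0 <= c.
      apply: mulr_ge0 => //; apply: mulr_ge0 => //.
      by rewrite mulr_ge0 ?sqr_ge0.
    rewrite /H exprMn real_normK ?num_real//.
    rewrite [leLHS](_ : _ = c * expR (`|t| * C)); last by rewrite /c; ring.
    rewrite [leRHS](_ : _ = c * expR C); last by rewrite /c; ring.
    exact: ler_wpM2l.
  have := qpos t te; rewrite -[_ *: _]/(t * q (A x)) in hq *; lra.
apply/eqP; apply: contraT => a0.
set a := q (A x) in step a0.
have na0 : 0 < `|a| by rewrite normr_gt0.
(* A small time at which the linear term would outweigh the quadratic one. *)
pose s := Num.min (Num.min e 1) (`|a| / (H + 1)) / 2.
have H1 : 0 < H + 1 by lra.
have m0 : 0 < Num.min (Num.min e 1) (`|a| / (H + 1)).
  by rewrite !lt_min e0 ltr01 divr_gt0.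
have s0 : 0 < s by rewrite divr_gt0.
have s2 : s < Num.min (Num.min e 1) (`|a| / (H + 1)) by rewrite /s; lra.
move: s2; rewrite !lt_min -andbA => /and3P[se s1].
rewrite ltr_pdivlMr// => sa.
have ns : `|s| = s by rewrite gtr0_norm.
have := step s; have := step (- s).
rewrite normrN ns => /(_ se (ltW s1)) h1 /(_ se (ltW s1)) h2.
have h : s * `|a| <= s * (H * s).
  by move: h1 h2; rewrite sqrrN expr2 mulNr; case: (ger0P a) => _ h1 h2; lra.
by move: h; rewrite ler_pM2l// => h; lra.
Qed.

End TangentVanishing.

Section FacePreservation.
Variables (R : realType) (d : nat).
Variable A : {linear symmx R d -> symmx R d}.

(** Mapping the cone onto itself at times [t >= 0] gives positivity at negative
    times too: [X = exp (- t A) Y] with [Y] in the cone and [t < 0], and then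
    [exp (t A) X = Y]. *)
Lemma psdmx_face_invariant (e : R) : 0 < e ->
  (forall t : R, 0 <= t < e -> opexp (t \*: A) @` psdmx R d = psdmx R d) ->
  forall X v, psdmx R d X -> quad v (val X) = 0 -> quad v (val (A X)) = 0.
Proof.
move=> e0 Aimg X v Xpsd.
pose q : {linear symmx R d -> R^o} :=
  quad v \o (val : {linear symmx R d -> 'M[R]_d}).
have qc : continuous q.
  move=> Y; apply: continuous_comp; first exact: symmx_val_continuous.
  exact: mx_linear_continuous.
apply: (@opexp_tangent0 R _ q A X e) => //.
  exact: symmx_linear_continuous.
move=> t te.
have [t0|t0] := leP 0 t.
  have t_in : 0 <= t < e by rewrite t0 -(ger0_norm t0).
  have : (opexp (t \*: A) @` psdmx R d) (opexp (t \*: A) X) by exists X.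
  by rewrite (Aimg t t_in) => /(_ v).
have [Y Ypsd XE] : (opexp (- t \*: A) @` psdmx R d) X.
  by rewrite (Aimg (- t))// oppr_ge0 ltW//= -(ltr0_norm t0).
by rewrite -XE opexp_scaleK; exact: Ypsd.
Qed.

End FacePreservation.

(** * Operators preserving the faces of the cone *)

Section LyapunovForm.
Variables (R : realType) (d : nat).
Implicit Types (u v : 'cV[R]_d) (i j : 'I_d).

Fact outer_subproof u : u *m u^T \is (symmetricmx : qualifier 0 'M[R]_d).
Proof. by apply/symmetricmxP; rewrite trmx_mul trmxK. Qed.

Definition outer u : symmx R d := SymMx (outer_subproof u).

Lemma quad_outer v u : quad v (val (outer u)) = ((u^T *m v) 0 0) ^+ 2.
Proof.
have -> : quad v (val (outer u)) = ((v^T *m u) *m (u^T *m v)) 0 0.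
  by rewrite /quad/= !mulmxA.
have -> : v^T *m u = (u^T *m v)^T by rewrite trmx_mul trmxK.
by rewrite mxE big_ord1 [X in X * _]mxE expr2.
Qed.

Lemma outer_psd u : psdmx R d (outer u).
Proof.
by move=> v; rewrite -[X in 0 <= X]/(quad v (val (outer u))) quad_outer sqr_ge0.
Qed.

Lemma outer_delta_comb (a b : R) i j :
  outer (a *: delta_mx i 0 + b *: delta_mx j 0) =
  a ^+ 2 *: sym_delta R i i + b ^+ 2 *: sym_delta R j j +
  (2 * a * b) *: sym_delta R i j.
Proof.
apply: val_inj; rewrite !raddfD/= !linearZ/=; apply/matrixP => k l.
by rewrite !mxE big_ord1 !mxE eqxx !andbT -!mulnb !natrM; field.
Qed.

Lemma outer_delta i : outer (delta_mx i 0) = sym_delta R i i.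
Proof.
have := outer_delta_comb 1 0 i i.
by rewrite !scale1r expr1n expr0n/= mulr0 !scale0r !addr0 scale1r.
Qed.

Lemma sym_delta_diag i : val (sym_delta R i i) = delta_mx i i.
Proof. by rewrite -outer_delta /= trmx_delta mul_delta_mx. Qed.

Lemma mulmx_delta_diag (B : 'M[R]_d) i k l :
  (B *m delta_mx i i) k l = B k i * (l == i)%:R.
Proof.
rewrite mxE (bigD1 i)//= big1 ?addr0; first by rewrite mxE eqxx.
by move=> m /negPf mi; rewrite mxE mi mulr0.
Qed.

Lemma linear_sym_delta0 (W : lmodType R) (D : {linear symmx R d -> W}) :
  (forall i j, D (sym_delta R i j) = 0) -> forall X, D X = 0.
Proof.
move=> D0 X; rewrite (symmx_sum_delta X) linear_sum big1// => i _.
by rewrite linear_sum big1// => j _; rewrite linearZ/= D0 scaler0.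
Qed.

Variable A : {linear symmx R d -> symmx R d}.
Hypothesis A_face : forall X v, psdmx R d X ->
  quad v (val X) = 0 -> quad v (val (A X)) = 0.

Let A_orth u v : (u^T *m v) 0 0 = 0 -> quad v (val (A (outer u))) = 0.
Proof.
by move=> uv0; apply: A_face; [exact: outer_psd|rewrite quad_outer uv0 expr0n].
Qed.

(* If A X = B X + X B^T, then A (e_i e_i^T) and B have the same i-th column,
   except that the diagonal entry of B appears doubled in the former. *)
Let B : 'M[R]_d := \matrix_(k, i)
  ((if k == i then 2^-1 else 1) * val (A (sym_delta R i i)) k i).

Let D : {linear symmx R d -> 'M[R]_d} :=
  (val \o A) \- ((mulmx B \o val) \+ (mulmxr B^T \o val)).

Let DE X : D X = val (A X) - (B *m val X + val X *m B^T).
Proof. by []. Qed.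

Let D_sym X : (D X)^T = D X.
Proof.
rewrite DE linearB/= linearD/= !trmx_mul trmxK !trmx_symmx.
by rewrite [X in _ - X]addrC.
Qed.

Let D_orth u v : (u^T *m v) 0 0 = 0 -> quad v (D (outer u)) = 0.
Proof.
move=> uv0; have uv : u^T *m v = 0 by rewrite [LHS]mx11_scalar uv0 raddf0.
have vu : v^T *m u = 0 by rewrite -[LHS]trmxK trmx_mul trmxK uv trmx0.
rewrite DE linearB/= A_orth// sub0r linearD/= /quad.
have -> : v^T *m (B *m (u *m u^T)) *m v = 0 by rewrite -!mulmxA uv !mulmx0.
have -> : v^T *m ((u *m u^T) *m B^T) *m v = 0 by rewrite !mulmxA vu !mul0mx.
by rewrite !mxE addr0 oppr0.
Qed.

(* Outside row and column i, the matrix A (e_i e_i^T) is zero because its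
   quadratic form vanishes at e_k, e_l and e_k + e_l, which are orthogonal
   to e_i. *)
Let D_diag i : D (sym_delta R i i) = 0.
Proof.
pose S : 'M[R]_d := val (A (sym_delta R i i)).
have ST : S^T = S by exact: trmx_symmx.
apply/matrixP => k l; rewrite DE sym_delta_diag.
have -> : delta_mx i i *m B^T = (B *m delta_mx i i)^T.
  by rewrite trmx_mul trmx_delta.
have subE (P : 'M[R]_d) : (S - (P + P^T)) k l = S k l - (P k l + P l k).
  by rewrite !mxE.
rewrite subE !mulmx_delta_diag !mxE -/S.
have Sli : S i l = S l i by rewrite -[in LHS]ST mxE.
have [->|ki] := eqVneq k i; have [->|li] := eqVneq l i.
- by rewrite /=; field.
- by rewrite Sli /=; ring.
- by rewrite /=; ring.
have e_orth (m : 'I_d) : m != i ->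
    (delta_mx i 0 : 'cV[R]_d)^T *m (delta_mx m 0 : 'cV[R]_d) = 0.
  by move=> mi; rewrite trmx_delta mul_delta_mx_0// eq_sym.
have q0 v : (delta_mx i 0 : 'cV[R]_d)^T *m v = 0 -> quad v S = 0.
  by move=> iv; rewrite /S -outer_delta A_orth// iv mxE.
rewrite (quad_polar0 ST (q0 _ (e_orth k ki)) (q0 _ (e_orth l li))) /=.
  by ring.
by apply: q0; rewrite mulmxDr !e_orth// addr0.
Qed.

Let D_offdiag i j : i != j -> D (sym_delta R i j) = 0.
Proof.
move=> ij; apply: (@quad_eq0 _ _ _ i j (D_sym _)) => v.
(* In the span of e_i and e_j, this is the vector orthogonal to v. *)
pose u : 'cV[R]_d := v j 0 *: delta_mx i 0 + (- v i 0) *: delta_mx j 0.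
have uv : (u^T *m v) 0 0 = 0.
  rewrite /u linearD/= !linearZ/= !trmx_delta mulmxDl -!scalemxAl -!rowE !mxE.
  by ring.
have uE : D (outer u) = (2 * v j 0 * - v i 0) *: D (sym_delta R i j).
  rewrite /u outer_delta_comb 2!linearD 3!linearZ_LR !D_diag.
  by rewrite !scaler0 !add0r.
have := D_orth uv; rewrite uE linearZ_LR.
rewrite -[LHS]/((2 * v j 0 * - v i 0) * quad v (D (sym_delta R i j))) => h; lra.
Qed.

(** The difference [D] of [A] and the Lyapunov operator of [B] vanishes on a
    spanning family: on [e_i e_i^T] by the choice of [B], and on
    [e_i e_j^T + e_j e_i^T] because the orthogonality condition for
    [u = v_j e_i - v_i e_j] reads
    [v_i v_j v^T D(e_i e_j^T + e_j e_i^T) v = 0]. *)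
Lemma face_invariant_lyapunov :
  exists B : 'M[R]_d, forall X : symmx R d, A X = B *m X + X *m B^T :> 'M[R]_d.
Proof.
exists B => X; apply/eqP; rewrite -subr_eq0; apply/eqP.
apply: (linear_sym_delta0 (D := D)) => i j.
by have [<-|] := eqVneq i j; [exact: D_diag|exact: D_offdiag].
Qed.

End LyapunovForm.

(** * The characterization *)

Theorem theorem3p3 (R : realType) (d : nat) :
  (forall A : {linear symmx R d -> symmx R d},
     (forall t : R, 0 <= t -> opexp (t \*: A) @` psdmx R d = psdmx R d) <->
     (exists B : 'M[R]_d, forall X : symmx R d,
        A X = B *m X + X *m B^T :> 'M[R]_d)) /\
  (forall A : {linear symmx R d -> symmx R d},
     (exists2 eps : R, 0 < eps &
        forall t : R, 0 <= t < eps ->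
          opexp (t \*: A) @` psdmx R d = psdmx R d) ->
     forall t : R, opexp (t \*: A) @` psdmx R d = psdmx R d).
Proof.
have lyap (A : {linear symmx R d -> symmx R d}) (eps : R) : 0 < eps ->
    (forall t : R, 0 <= t < eps -> opexp (t \*: A) @` psdmx R d = psdmx R d) ->
    exists B : 'M[R]_d, forall X : symmx R d,
      A X = B *m X + X *m B^T :> 'M[R]_d.
  by move=> e0 /(psdmx_face_invariant e0); exact: face_invariant_lyapunov.
split=> A; last by case=> e e0 /(lyap _ _ e0)[B] /lyapunov_opexp_psdmx.
split=> [Aimg|[B] /lyapunov_opexp_psdmx AB t _]; last exact: AB.
by apply: (lyap A 1) => // t /andP[t0 _]; exact: Aimg.
Qed.
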